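(* Let $R$ be a commutative integral domain with identity and let $n \geq 2$ be an integer. A multilinear polynomial function $p \colon R^n \to R$ is associative if and only if it is one of the following (where $\mathbf{x} = (x_1, \dots, x_n)$): (i) $p(\mathbf{x}) = c$, where $c \in R$; (ii) $p(\mathbf{x}) = x_1$; (iii) $p(\mathbf{x}) = x_n$; (iv) $p(\mathbf{x}) = c + \sum_{i=1}^n x_i$, where $c \in R$; (v) $p(\mathbf{x}) = \sum_{i=1}^n \omega^{i-1} x_i$ (if $n \geq 3$), where $\omega \in R \setminus \{1\}$ satisfies $\omega^{n-1} = 1$; (vi) $p(\mathbf{x}) = -b + a \prod_{i=1}^n (x_i + b)$, where $a \in R \setminus \{0\}$ and $b$ is an element of the field of fractions of $R$ such that $ab^n - b \in R$ and $ab^k \in R$ for every $k \in \{1, \dots, n-1\}$.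
   Context: The domain $R$ may be finite or infinite. A multilinear polynomial function $p \colon R^n \to R$ is a function induced by a polynomial in $R[x_1, \dots, x_n]$ in which no variable occurs with an exponent higher than $1$. An operation $f \colon A^n \to A$ on a set $A$ is associative if for all $i, j \in \{0, \dots, n-1\}$ the equality $$f(a_1, \dots, a_i, f(a_{i+1}, \dots, a_{i+n}), a_{i+n+1}, \dots, a_{2n-1}) = f(a_1, \dots, a_j, f(a_{j+1}, \dots, a_{j+n}), a_{j+n+1}, \dots, a_{2n-1})$$ holds for all $a_1, \dots, a_{2n-1} \in A$. *)

(* Defs.v *)
From HB Require Import structures.
From mathcomp Require Import all_boot all_order all_algebra.
From mathcomp Require Import zify.
From mathcomp Require Import mpoly.

Set Implicit Arguments.
Unset Strict Implicit.
Unset Printing Implicit Defensive.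

Import GRing.Theory.
Local Open Scope ring_scope.

Notation "x %:F" := (@FracField.tofrac _ x) : ring_scope.

Section AssociativeOperation.
Variables (A : Type) (n : nat).

Fact idx_left_proof (k : 'I_n) : (k < 2 * n - 1)%N.
Proof. by have := ltn_ord k; lia. Qed.

Fact idx_mid_proof (i k : 'I_n) : (i + k < 2 * n - 1)%N.
Proof. by have := ltn_ord i; have := ltn_ord k; lia. Qed.

Fact idx_right_proof (k : 'I_n) : (k + (n - 1) < 2 * n - 1)%N.
Proof. by have := ltn_ord k; lia. Qed.

Definition idx_left (k : 'I_n) : 'I_(2 * n - 1) := Ordinal (idx_left_proof k).
Definition idx_mid (i k : 'I_n) : 'I_(2 * n - 1) := Ordinal (idx_mid_proof i k).
Definition idx_right (k : 'I_n) : 'I_(2 * n - 1) := Ordinal (idx_right_proof k).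

(* f(a_1,..,a_i, f(a_{i+1},..,a_{i+n}), a_{i+n+1},..,a_{2n-1}), where the
   1-based a_k is stored at index k - 1. *)
Definition nested (f : {ffun 'I_n -> A} -> A) (i : 'I_n)
    (a : {ffun 'I_(2 * n - 1) -> A}) : A :=
  f [ffun k : 'I_n =>
       if (k < i)%N then a (idx_left k)
       else if k == i then f [ffun l : 'I_n => a (idx_mid i l)]
       else a (idx_right k)].

Definition associative_op (f : {ffun 'I_n -> A} -> A) : Prop :=
  forall (i j : 'I_n) (a : {ffun 'I_(2 * n - 1) -> A}),
    nested f i a = nested f j a.

End AssociativeOperation.

Definition multilinear_poly (R : idomainType) (n : nat) (P : {mpoly R[n]}) :
    Prop :=
  forall m : 'X_{1..n}, m \in msupp P -> forall i : 'I_n, (m i <= 1)%N.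

Definition multilinear_polyfun (R : idomainType) (n : nat)
    (p : {ffun 'I_n -> R} -> R) : Prop :=
  exists2 P : {mpoly R[n]}, multilinear_poly P & forall x, p x = P.@[x].

Definition in_base (R : idomainType) (z : {fraction R}) : Prop :=
  exists r : R, z = r%:F.

(* Main.v *)
(* Let G w = p(1, w) - p(0, w) be the coefficient of x_1 in p.  Comparing the
   coefficient of a_1 on both sides of associativity at the first two positions
   gives G(w) G(y, z) = G(p(w, y), z).
   - If x_1 x_2 really occurs, i.e. G(y, z) = g0 + y g1 with g1 <> 0 for some z,
     then with b = g0 / g1 the coefficients of y give
     p(w, y) + b = (y + b) G(w).  So q = p + b satisfies the recursion
     q(w, y) = (y + b) (q(1, w) - q(0, w)), which forces
     q = a prod (x_i + b).
   - Otherwise G(w) G(0, z) = G(0, z), so G is constantly 0 or constantly 1.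
     If G = 0, comparing the first and last positions gives
     p(0, z) = p(v, p(0, z)) for all v, so p is constant or the last projection.
     If G = 1, then p(x, v) = x + r(v) with
     r(x, v) = w x + w r(v, y) - w y, and unrolling the shift gives
     p = c + sum w^i x_i with w c = c and w^n = w. *)
Require Import Defs.
From HB Require Import structures.
From mathcomp Require Import all_boot all_order all_algebra.
From mathcomp Require Import zify ring.
From mathcomp Require Import mpoly.
From Stdlib Require Import Classical.

Set Implicit Arguments.
Unset Strict Implicit.
Unset Printing Implicit Defensive.

Import GRing.Theory.
Local Open Scope ring_scope.

(** * Affinity in each variable, and arguments written as sequences *)

Lemma multilinear_affine (R : idomainType) (n : nat)
    (p : {ffun 'I_n -> R} -> R) (i : 'I_n) (x0 x1 xt : {ffun 'I_n -> R}) :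
  multilinear_polyfun p ->
  x0 i = 0 -> x1 i = 1 ->
  (forall j, j != i -> x1 j = x0 j) -> (forall j, j != i -> xt j = x0 j) ->
  p xt = p x0 + xt i * (p x1 - p x0).
Proof.
move=> [P mulP pE] e0 e1 h1 ht; rewrite !pE !mevalE -sumrB mulr_sumr -big_split /=.
rewrite !big_seq; apply: eq_bigr => m /mulP/(_ i).
rewrite ![\prod_(j < n) _](bigD1 i) //= e0 e1.
have K1 : \prod_(j < n | j != i) x1 j ^+ m j = \prod_(j < n | j != i) x0 j ^+ m j.
  by apply: eq_bigr => j /h1 ->.
have Kt : \prod_(j < n | j != i) xt j ^+ m j = \prod_(j < n | j != i) x0 j ^+ m j.
  by apply: eq_bigr => j /ht ->.
rewrite K1 Kt.
by case: (m i) => [|[|//]] _; rewrite ?expr0 ?expr1 ?expr1n; ring.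
Qed.

Section SequenceForm.
Variables (R : idomainType) (n : nat) (p : {ffun 'I_n -> R} -> R).

(** Sequences let arguments be consed, appended and cut. Missing entries are read as 0 and entries
    from index [n] on are ignored. *)
Definition seqfun (s : seq R) : R := p [ffun k : 'I_n => s`_k].

Lemma seqfun_codom (x : {ffun 'I_n -> R}) :
  p x = seqfun [seq x i | i <- enum 'I_n].
Proof.
congr p; apply/ffunP => k; rewrite ffunE (nth_map k) ?size_enum_ord //.
by rewrite nth_ord_enum.
Qed.

Lemma seqfun_affine (s1 s2 : seq R) (t : R) :
  multilinear_polyfun p -> (size s1 < n)%N ->
  seqfun (s1 ++ t :: s2) = seqfun (s1 ++ 0 :: s2)
    + t * (seqfun (s1 ++ 1 :: s2) - seqfun (s1 ++ 0 :: s2)).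
Proof.
move=> hp s1n; pose i := Ordinal s1n.
have at_i u : [ffun k : 'I_n => (s1 ++ u :: s2)`_k] i = u.
  by rewrite ffunE nth_cat /= ltnn subnn.
have off_i u v (j : 'I_n) : j != i ->
    [ffun k : 'I_n => (s1 ++ u :: s2)`_k] j
      = [ffun k : 'I_n => (s1 ++ v :: s2)`_k] j.
  rewrite -val_eqE /= !ffunE !nth_cat => ji; case: ltnP => // le.
  by have /prednK <- : (0 < j - size s1)%N by lia.
have := multilinear_affine (i := i) hp (at_i 0) (at_i 1) (off_i 1 0) (off_i t 0).
by rewrite at_i.
Qed.

Lemma nested_seqfun (i : 'I_n) (s : seq R) :
  size s = (2 * n - 1)%N ->
  nested p i [ffun k : 'I_(2 * n - 1) => s`_k]
    = seqfun (take i s ++ seqfun (take n (drop i s)) :: drop (i + n) s).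
Proof.
move=> ss; have lti := ltn_ord i; congr p; apply/ffunP => k; rewrite !ffunE /=.
have sti : size (take i s) = i by rewrite size_takel //; lia.
rewrite nth_cat sti; case: ltnP => [ki|ik]; first by rewrite nth_take.
have [->|] := eqVneq k i.
  rewrite subnn /=; congr p; apply/ffunP => l; rewrite !ffunE /=.
  by rewrite nth_take // nth_drop.
rewrite -val_eqE /= => ne; have lt : (i < k)%N by lia.
have -> : (k - i = (k - i).-1.+1)%N by lia.
rewrite /= nth_drop; congr (s`_ _); lia.
Qed.

End SequenceForm.

(** * Solving the two recursions, and coefficients lying in the base ring *)

(** The difference of [Q] in its first argument satisfies the same recursion with one argument
    fewer, so induction applies to it. Both formulas share one [a]; the one for differences later
    shows that coefficients lie in [R]. *)
Lemma product_of_difference_recursion (R : pzRingType) (F : comPzRingType)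
    (iota : R -> F) (b : F) (m : nat) (Q : seq R -> F) :
  (forall w y, size w = m ->
     Q (rcons w y) = (iota y + b) * (Q (1 :: w) - Q (0 :: w))) ->
  exists a : F,
    (forall w, size w = m ->
       Q (1 :: w) - Q (0 :: w) = a * \prod_(y <- w) (iota y + b)) /\
    (forall s, size s = m.+1 -> Q s = a * \prod_(y <- s) (iota y + b)).
Proof.
elim: m Q => [|m IH] Q hQ.
  exists (Q [:: 1] - Q [:: 0]); split=> [w /size0nil ->|[|y [|//]] // _].
    by rewrite big_nil mulr1.
  by rewrite (hQ [::]) // big_seq1 mulrC.
have [w y sw|a [_ aE]] := IH (fun w => Q (1 :: w) - Q (0 :: w)).
  by rewrite -!rcons_cons !hQ /= ?sw // -mulrBr.
exists a; split=> // s; case/lastP: s => // w y; rewrite size_rcons => -[sw].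
by rewrite hQ // aE // -cats1 big_cat big_seq1 /=; ring.
Qed.

Lemma in_baseB (R : idomainType) (u v : {fraction R}) :
  in_base u -> in_base v -> in_base (u - v).
Proof. by move=> [r ->] [s ->]; exists (r - s); rewrite rmorphB. Qed.

(** Since [(1 + b) - (0 + b) = 1], differencing in one argument removes one factor; the all-zero
    sequence then gives the top power of [b]. *)
Lemma in_base_coefs (R : idomainType) (a b : {fraction R}) (m : nat) :
  (forall s : seq R, size s = m -> in_base (a * \prod_(y <- s) (y%:F + b))) ->
  forall k, (k <= m)%N -> in_base (a * b ^+ k).
Proof.
elim: m => [|m IH] hm k km.
  by have := hm [::] erefl; rewrite big_nil; case: k km.
move: km; rewrite leq_eqVlt => /predU1P[->|km].
  have := hm (nseq m.+1 0) (size_nseq _ _).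
  by rewrite big_nseq rmorph0 add0r -Monoid.iteropE /=.
apply: IH km => s ss.
have := in_baseB (hm (1 :: s) (congr1 S ss)) (hm (0 :: s) (congr1 S ss)).
by rewrite !big_cons rmorph0 rmorph1; congr in_base; ring.
Qed.

Lemma rcons_nseq (T : Type) (k : nat) (x : T) : rcons (nseq k x) x = nseq k.+1 x.
Proof. by elim: k => //= k ->. Qed.

(** Each use of the hypothesis removes the head and appends a 0; after [m.+1] uses only zeros
    remain. *)
Lemma unroll_shift (R : comPzRingType) (w : R) (r : seq R -> R) (m : nat) :
  (forall x v, size v = m -> r (x :: v) = w * x + w * r (rcons v 0)) ->
  forall s, size s = m.+1 ->
  r s = \sum_(i < m.+1) w ^+ i.+1 * s`_i + w ^+ m.+1 * r (nseq m.+1 0).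
Proof.
move=> hr s ss.
suff H k : (k <= m.+1)%N ->
    r s = \sum_(i < k) w ^+ i.+1 * s`_i + w ^+ k * r (drop k s ++ nseq k 0).
  by rewrite (H m.+1) // drop_oversize ?ss.
elim: k => [|k IH] km.
  by rewrite big_ord0 expr0 mul1r add0r drop0 cats0.
rewrite IH; last exact: ltnW.
rewrite (drop_nth 0) ?ss //= hr; last first.
  by rewrite size_cat size_drop size_nseq ss; lia.
rewrite big_ord_recr /= -cats1 -catA cats1 rcons_nseq.
by rewrite exprS; ring.
Qed.

(** * Associativity of the listed operations *)

(** The inner block covers the indices from [i] to [i + n - 1], and the outer arguments cover the
    others once each. Hence the result is independent of [i]; it serves both sums and products. *)
Lemma big_nested (A : Type) (idx : A) (op : Monoid.com_law idx) (n : nat)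
    (i : 'I_n) (c : A) (F : nat -> A) :
  \big[op/idx]_(k < n)
    (if (k < i)%N then F k
     else if k == i then op c (\big[op/idx]_(l < n) F (i + l)%N)
     else F (k + (n - 1))%N)
  = op c (\big[op/idx]_(j < 2 * n - 1) F j).
Proof.
have lti := ltn_ord i.
set B := \big[op/idx]_(l < n) F (i + l)%N.
have BE : B = \big[op/idx]_(i <= j < i + n) F j.
  rewrite -[X in index_iota X _]add0n big_addn addKn big_mkord.
  by apply: eq_bigr => l _; rewrite addnC.
pose u k := if (k < i)%N then F k
            else if k == i :> nat then op c B else F (k + (n - 1))%N.
rewrite (eq_bigr (fun k : 'I_n => u k)) //.
rewrite -(big_mkord xpredT F) -(big_mkord xpredT u).
rewrite (big_cat_nat (n := i)) ?(ltnW lti) //=.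
rewrite [X in op _ X]big_ltn //.
rewrite [in RHS](big_cat_nat (n := i)) //=; last by lia.
rewrite [X in op c (op _ X)](big_cat_nat (n := (i + n)%N)) /=; try by lia.
rewrite -BE {2}/u ltnn eqxx -!Monoid.mulmA [LHS]Monoid.mulmCA.
congr (op c (op _ (op _ _))).
  by rewrite !big_nat; apply: eq_bigr => k /andP[_ ki]; rewrite /u ki.
have -> : (i + n = i.+1 + (n - 1))%N by lia.
have -> : (2 * n - 1 = n + (n - 1))%N by lia.
rewrite big_addn addnK !big_nat; apply: eq_bigr => k /andP[ik _].
by rewrite /u ltnNge (ltnW ik) /= gtn_eqF.
Qed.

Lemma big_nested_ffun (A B : Type) (idx : B) (op : Monoid.com_law idx) (n : nat)
    (i : 'I_n) (c : B) (a : {ffun 'I_(2 * n - 1) -> A}) (F : nat -> A -> B) :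
  \big[op/idx]_(k < n)
    (if (k < i)%N then F k (a (idx_left k))
     else if k == i then op c (\big[op/idx]_(l < n) F (i + l)%N (a (idx_mid i l)))
     else F (k + (n - 1))%N (a (idx_right k)))
  = op c (\big[op/idx]_(j < 2 * n - 1) F j (a j)).
Proof.
(* Extends the family to all naturals, with value [idx] out of range, so that [big_nested]
   applies. *)
pose G j := if insub j is Some o then F j (a o) else idx.
have GE (o : 'I_(2 * n - 1)) (j : nat) : j = o -> G j = F j (a o).
  by move=> ->; rewrite /G valK.
rewrite (eq_bigr (fun j : 'I_(2 * n - 1) => G j)); last first.
  by move=> j _; rewrite (GE j).
rewrite -(big_nested op i); apply: eq_bigr => k _.
rewrite (GE (idx_left k) k) // (GE (idx_right k) (k + (n - 1))%N) //.
by under [in RHS]eq_bigr => l _ do rewrite (GE (idx_mid i l) (i + l)%N) //.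
Qed.

(** Arguments after the block keep their weight because [w ^+ (n - 1) = 1], and the inner constant
    survives multiplication by [w ^+ i] because [w * c = c]. *)
Lemma associative_twisted_sum (R : comPzRingType) (n : nat) (w c : R)
    (p : {ffun 'I_n -> R} -> R) :
  w ^+ (n - 1) = 1 -> w * c = c ->
  (forall x, p x = c + \sum_(i < n) w ^+ i * x i) -> associative_op p.
Proof.
move=> wn wc pE; have wic i : w ^+ i * c = c.
  by elim: i => [|i IH]; rewrite ?mul1r // exprSr -mulrA wc.
suff H i a : nested p i a = c + (c + \sum_(j < 2 * n - 1) w ^+ j * a j).
  by move=> i j a; rewrite !H.
rewrite /nested pE; congr (c + _).
rewrite -(big_nested_ffun +%R i c a (fun k y => w ^+ k * y)).
apply: eq_bigr => k _; rewrite ffunE; case: ltnP => // _.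
case: eqVneq => [->|_]; last by rewrite exprD wn mulr1.
rewrite pE mulrDr wic mulr_sumr; congr (c + _); apply: eq_bigr => l _.
by rewrite ffunE exprD mulrA.
Qed.

(** Adding [b] to the inner value cancels its [- b], leaving a pure product that the outer product
    absorbs. *)
Lemma associative_shifted_prod (R : idomainType) (n : nat) (a : R)
    (b : {fraction R}) (p : {ffun 'I_n -> R} -> R) :
  (forall x, (p x)%:F = - b + a%:F * \prod_(i < n) ((x i)%:F + b)) ->
  associative_op p.
Proof.
move=> pE.
suff H i z : (nested p i z)%:F
    = - b + a%:F * (a%:F * \prod_(j < 2 * n - 1) ((z j)%:F + b)).
  by move=> i j z; apply/eqP; rewrite -tofrac_eq !H.
rewrite /nested pE; congr (- b + _ * _).
rewrite -(big_nested_ffun *%R i a%:F z (fun _ y => y%:F + b)).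
apply: eq_bigr => k _; rewrite ffunE; case: ltnP => // _.
case: eqVneq => // _; rewrite pE addrC addNKr; congr (_ * _).
by apply: eq_bigr => l _; rewrite ffunE.
Qed.

(** * Classification of the associative multilinear functions *)

Lemma scaled_factorization (F : comPzRingType) (g0 g1 b q y d : F) :
  g1 * b = g0 -> g1 * q + g0 = (g0 + y * g1) * d ->
  g1 * (q + b) = g1 * ((y + b) * d).
Proof. by move=> <- e; rewrite mulrDr e; ring. Qed.

Section Classification.
Variables (R : idomainType) (n : nat) (p : {ffun 'I_n -> R} -> R).
Hypotheses (n_ge2 : (2 <= n)%N) (p_multi : multilinear_polyfun p).
Hypothesis p_assoc : associative_op p.

Let P := seqfun p.
Let G (w : seq R) := P (1 :: w) - P (0 :: w).
(** The slope in the last variable, the mirror image of [G]. *)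
Let H (w : seq R) := P (rcons w 1) - P (rcons w 0).

Let P_consE y w : P (y :: w) = P (0 :: w) + y * G w.
Proof. by apply: (@seqfun_affine _ _ _ [::]) => //=; lia. Qed.

Let P_rconsE y w : (size w < n)%N -> P (rcons w y) = P (rcons w 0) + y * H w.
Proof. by rewrite /H -!cats1; apply: seqfun_affine. Qed.

Let P_cons2E x y w : P (x :: y :: w)
   = P (x :: 0 :: w) + y * (P (x :: 1 :: w) - P (x :: 0 :: w)).
Proof. by apply: (@seqfun_affine _ _ _ [:: x]) => //=; lia. Qed.

Let G_consE y z : G (y :: z) = G (0 :: z) + y * (G (1 :: z) - G (0 :: z)).
Proof. by rewrite /G P_cons2E (P_cons2E 0); ring. Qed.

Lemma nested_first_second x w y z : size w = (n - 1)%N -> size z = (n - 2)%N ->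
  P (P (x :: w) :: y :: z) = P (x :: P (rcons w y) :: z).
Proof.
move=> sw sz; have n0 : (0 < n)%N by lia. have n1 : (1 < n)%N by lia.
have sxw : size (x :: w) = n by rewrite /= sw; lia.
have swy : size (rcons w y) = n by rewrite size_rcons sw; lia.
pose s := (x :: w) ++ y :: z.
(* Associativity is evaluated at the concatenation of [x], [w], [y], [z], of length
   [1 + (n - 1) + 1 + (n - 2)]. *)
have ss : size s = (2 * n - 1)%N by rewrite size_cat sxw /= sz; lia.
have := p_assoc (Ordinal n0) (Ordinal n1) [ffun k : 'I_(2 * n - 1) => s`_k].
rewrite !nested_seqfun // [nat_of_ord (Ordinal n0)]/= [nat_of_ord (Ordinal n1)]/=.
rewrite take0 drop0 add0n add1n [take n s]take_size_cat //.
rewrite [drop n s]drop_size_cat // /s /= take0 drop0.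
by rewrite -(cat_rcons y w z) take_size_cat // drop_size_cat.
Qed.

Lemma nested_first_last v t z : size v = (n - 1)%N -> size z = (n - 1)%N ->
  P (P (rcons v t) :: z) = P (rcons v (P (t :: z))).
Proof.
move=> sv sz; have n0 : (0 < n)%N by lia. have n1 : (n - 1 < n)%N by lia.
pose s := v ++ t :: z.
have ss : size s = (2 * n - 1)%N by rewrite size_cat /= sv sz; lia.
have := p_assoc (Ordinal n0) (Ordinal n1) [ffun k : 'I_(2 * n - 1) => s`_k].
rewrite !nested_seqfun // [nat_of_ord (Ordinal n0)]/= [nat_of_ord (Ordinal n1)]/=.
have stz : size (t :: z) = n by rewrite /= sz; lia.
have svt : size (rcons v t) = n by rewrite size_rcons sv; lia.
rewrite take0 drop0 add0n [take (n - 1) s]take_size_cat //.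
rewrite [drop (n - 1) s]drop_size_cat //.
rewrite [take n (t :: z)]take_oversize ?stz //.
rewrite [drop (_ + _) s]drop_oversize ?ss; last by lia.
by rewrite /s -(cat_rcons t v z) take_size_cat // drop_size_cat // cats1.
Qed.

Lemma head_slope_mul w y z : size w = (n - 1)%N -> size z = (n - 2)%N ->
  G w * G (y :: z) = G (P (rcons w y) :: z).
Proof.
move=> sw sz; rewrite [in RHS]/G -!nested_first_second // !(P_consE (P _)).
by rewrite {1}/G; ring.
Qed.

Lemma shifted_prod_of_mixed_term z :
  size z = (n - 2)%N -> G (1 :: z) - G (0 :: z) != 0 ->
  exists (a : R) (b : {fraction R}),
         [/\ a != 0,
             in_base (a%:F * b ^+ n - b),
             forall k : nat, (1 <= k <= n - 1)%N -> in_base (a%:F * b ^+ k)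
           & forall x, (p x)%:F = - b + a%:F * \prod_(i < n) ((x i)%:F + b)].
Proof.
move=> sz; pose g0 := G (0 :: z); set g1 := _ - _ => g1N0.
have key w y : size w = (n - 1)%N ->
    g1 * P (rcons w y) + g0 = (g0 + y * g1) * G w.
  move=> sw.
  have e0 := head_slope_mul 0 sw sz; have e1 := head_slope_mul 1 sw sz.
  rewrite G_consE (G_consE (P _)) -/g0 -/g1 in e0.
  rewrite G_consE (G_consE (P _)) -/g0 -/g1 in e1.
  rewrite P_rconsE ?sw; last by lia.
  rewrite [P (rcons w 1)]P_rconsE ?sw in e1; last by lia.
  (* Both sides of [key] are affine in [y], so the cases 0 and 1 are interpolated. *)
  have -> : (g0 + y * g1) * G w
      = (1 - y) * (G w * (g0 + 0 * g1)) + y * (G w * (g0 + 1 * g1)) by ring.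
  by rewrite e0 e1; ring.
pose b : {fraction R} := g0%:F / g1%:F.
have addDB (u v c : {fraction R}) : u + c - (v + c) = u - v by ring.
have g1F : g1%:F != 0 :> {fraction R} by rewrite tofrac_eq0.
have [w y sw|a [aG aP]] := @product_of_difference_recursion R _ (@tofrac R) b (n - 1)
    (fun s => (P s)%:F + b).
  clearbody g1 g0; apply: (mulfI g1F).
  have := congr1 (@tofrac R) (key w y sw).
  rewrite /G !(rmorphD, rmorphM, rmorphN) /= => e.
  rewrite addDB; apply: scaled_factorization e.
  by rewrite mulrC divfK.
(* The shift [b] cancels in a difference of values, leaving [G s], an element of [R]. *)
have base s : size s = (n - 1)%N -> in_base (a * \prod_(y <- s) (y%:F + b)).
  by move=> ss; rewrite -aG // addDB; exists (G s); rewrite rmorphB.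
have coef := in_base_coefs base.
have [a' aE] : in_base a by have := coef 0%N; rewrite expr0 mulr1; apply.
have pE x : (p x)%:F = - b + a'%:F * \prod_(i < n) ((x i)%:F + b).
  have sx : size [seq x i | i <- enum 'I_n] = (n - 1).+1.
    by rewrite size_map size_enum_ord; lia.
  by rewrite seqfun_codom -aE -[LHS](addrK b) aP // big_map big_enum /= addrC.
exists a', b; split=> //; last by move=> k /andP[_ kn]; rewrite -aE; apply: coef.
(* If [a] vanished, so would [G], and with it [g1]. *)
- apply: contraNneq g1N0 => a0.
  have G0 w : size w = (n - 1)%N -> G w = 0.
    move=> sw; apply/eqP; rewrite -tofrac_eq0; apply/eqP.
    by rewrite rmorphB -(addDB _ _ b) aG // aE a0 mul0r.
  have syz y : size (y :: z) = (n - 1)%N by rewrite /= sz; lia.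
  by rewrite /g1 (G0 _ (syz 1)) (G0 _ (syz 0)) subrr.
(* The element [a * b ^+ n - b] is the value of [p] at the origin. *)
- exists (p [ffun=> 0]); rewrite pE addrC; congr (- b + _ * _).
  by rewrite (eq_bigr (fun=> b)) ?prodr_const ?card_ord // => i _;
    rewrite ffunE rmorph0 add0r.
Qed.

Lemma head_slope_0_or_1 : (forall z, size z = (n - 2)%N -> G (1 :: z) - G (0 :: z) = 0) ->
  (forall w, size w = (n - 1)%N -> G w = 0) \/
  (forall w, size w = (n - 1)%N -> G w = 1).
Proof.
move=> G1; have GE y z : size z = (n - 2)%N -> G (y :: z) = G (0 :: z).
  by move=> sz; rewrite G_consE G1 // mulr0 addr0.
have [[z [sz gz]]|none] := classic (exists z, size z = (n - 2)%N /\ G (0 :: z) <> 0).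
  right=> w sw; apply: (mulIf (introN eqP gz)).
  by rewrite mul1r head_slope_mul // GE.
left=> -[|y z] sw; first by move: sw => /=; lia.
have sz : size z = (n - 2)%N by move: sw => /=; lia.
by rewrite GE //; apply: NNPP => gz; apply: none; exists z.
Qed.

Lemma const_or_last_of_head_slope_0 : (forall w, size w = (n - 1)%N -> G w = 0) ->
  (exists c, forall s, size s = n -> P s = c) \/
  (forall v y, size v = (n - 1)%N -> P (rcons v y) = y).
Proof.
move=> G0; have PE y z : size z = (n - 1)%N -> P (y :: z) = P (0 :: z).
  by move=> sz; rewrite P_consE G0 // mulr0 addr0.
(* As the first argument has no effect, every value of [P] is a fixed point of the affine map
   sending [t] to [P (rcons v t)]. *)
have key v z : size v = (n - 1)%N -> size z = (n - 1)%N ->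
    P (0 :: z) = P (rcons v 0) + P (0 :: z) * H v.
  by move=> sv sz; rewrite -P_rconsE ?sv -?nested_first_last ?PE //; lia.
have [[z [sz neq]]|none] := classic (exists z, size z = (n - 1)%N /\
    P (0 :: z) <> P (0 :: nseq (n - 1) 0)).
  right=> v y sv; have s0 := size_nseq (n - 1) (0 : R).
  (* An affine map with two distinct fixed points has slope 1 and constant term 0. *)
  have H1 : H v = 1.
    apply: (mulfI (x := P (0 :: z) - P (0 :: nseq (n - 1) 0))).
      by rewrite subr_eq0; apply/eqP.
    by rewrite [in RHS](key v z) // [in RHS](key v (nseq (n - 1) 0)) //; ring.
  have := key v z sv sz; rewrite H1 mulr1 -[LHS]add0r => /addIr e.
  by rewrite P_rconsE ?sv ?H1 -?e ?add0r ?mulr1 //; lia.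
left; exists (P (0 :: nseq (n - 1) 0)) => -[|y z] ss; first by move: ss => /=; lia.
have sz : size z = (n - 1)%N by move: ss => /=; lia.
by rewrite PE //; apply: NNPP => neq; apply: none; exists z.
Qed.

Lemma twisted_sum_of_head_slope_1 : (forall w, size w = (n - 1)%N -> G w = 1) ->
  exists w c : R, [/\ w * c = c, w ^+ n = w &
    forall s, size s = n -> P s = c + \sum_(i < n) w ^+ i * s`_i].
Proof.
move=> G1; pose r v := P (0 :: v).
have PE x v : size v = (n - 1)%N -> P (x :: v) = x + r v.
  by move=> sv; rewrite P_consE G1 // mulr1 addrC.
pose z : seq R := nseq (n - 2) 0; have sz : size z = (n - 2)%N by rewrite size_nseq.
(* The coefficient of [x_2] when the other variables are 0. *)
pose w := r (1 :: z) - r (0 :: z).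
have rE y : r (y :: z) = r (0 :: z) + y * w by rewrite /r P_cons2E.
have shift x v y : size v = (n - 2)%N ->
    r (x :: v) = w * x + w * r (rcons v y) - w * y.
  move=> sv; have sxv : size (x :: v) = (n - 1)%N by rewrite /= sv; lia.
  (* With leading argument 0 and trailing zeros, both sides reduce to values of [r], and [rE] makes
     the slope [w] appear. *)
  have := nested_first_second 0 y sxv sz.
  rewrite (PE (P _)) /= ?sz; last by lia.
  rewrite (PE x) ?size_rcons ?sv; last by lia.
  rewrite -!/(r _) -/(r (x :: v)) rE (rE (x + _)) => e.
  have -> : r (x :: v) = r (x :: v) + (r (0 :: z) + y * w) - r (0 :: z) - y * w by ring.
  by rewrite e; ring.
have n2 : n = (n - 2).+2 by lia.
have shift0 x v : size v = (n - 2)%N -> r (x :: v) = w * x + w * r (rcons v 0).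
  by move=> sv; rewrite (shift x v 0) // mulr0 subr0.
have unroll := unroll_shift shift0.
pose c := r (nseq (n - 2).+1 0).
have wc : w * c = c by rewrite {2}/c /= shift0 // rcons_nseq mulr0 add0r.
have wkc k : w ^+ k * c = c.
  by elim: k => [|k IH]; rewrite ?mul1r // exprSr -mulrA wc.
have {}unroll s : size s = (n - 2).+1 ->
    r s = \sum_(i < (n - 2).+1) w ^+ i.+1 * s`_i + c.
  by move=> ss; rewrite unroll // wkc.
have wn : w ^+ n = w.
  (* A single 1 in last place: [unroll] gives it weight [w ^+ (n - 1)], so the relation reads
     [c = w ^+ n + w * c - w]. *)
  have := shift 0 z 1 sz; rewrite -[r (0 :: z)]/c unroll ?size_rcons ?sz //.
  rewrite big_ord_recr /= nth_rcons sz ltnn eqxx big1 => [|i _]; last first.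
    by rewrite nth_rcons sz ltn_ord nth_nseq if_same mulr0.
  move=> e; rewrite n2 exprS; set u := w ^+ _ in e *.
  have -> : w * u = (w * 0 + w * (0 + u * 1 + c) - w * 1) - w * c + w by ring.
  by rewrite -e wc subrr add0r.
exists w, c; split=> // -[|x s] ss; first by move: ss => /=; lia.
have ss' : size s = (n - 2).+1 by move: ss => /=; lia.
rewrite PE ?ss'; last by lia.
have -> : \sum_(i < n) w ^+ i * (x :: s)`_i
    = \sum_(i < (n - 2).+2) w ^+ i * (x :: s)`_i by rewrite -n2.
rewrite unroll // [in RHS]big_ord_recl expr0 mul1r /=.
by rewrite [RHS]addrC addrA.
Qed.

End Classification.

(** * Assembling the classification and its converse *)

Theorem theorem3p2 (R : idomainType) (n : nat) (hn : (2 <= n)%N)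
    (p : {ffun 'I_n -> R} -> R) (hp : multilinear_polyfun p) :
  associative_op p <->
  ((exists c : R, forall x, p x = c)
   \/ (exists2 i : 'I_n, i = 0%N :> nat & forall x, p x = x i)
   \/ (exists2 i : 'I_n, i = (n - 1)%N :> nat & forall x, p x = x i)
   \/ (exists c : R, forall x, p x = c + \sum_(i < n) x i)
   \/ ((3 <= n)%N /\
       exists w : R, [/\ w != 1, w ^+ (n - 1) = 1
         & forall x, p x = \sum_(i < n) w ^+ i * x i])
   \/ (exists (a : R) (b : {fraction R}),
         [/\ a != 0,
             in_base (a%:F * b ^+ n - b),
             forall k : nat, (1 <= k <= n - 1)%N -> in_base (a%:F * b ^+ k)
           & forall x, (p x)%:F = - b + a%:F * \prod_(i < n) ((x i)%:F + b)])).
Proof.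
pose t (x : {ffun 'I_n -> R}) := [seq x i | i <- enum 'I_n].
have st x : size (t x) = n by rewrite size_map size_enum_ord.
have nth_t x (i : 'I_n) : (t x)`_i = x i.
  by rewrite (nth_map i) ?size_enum_ord // nth_ord_enum.
split=> [passoc|].
  have [[z [sz gz]]|none] := classic (exists z : seq R, size z = (n - 2)%N /\
      let G w := seqfun p (1 :: w) - seqfun p (0 :: w) in
      G (1 :: z) - G (0 :: z) <> 0).
    do 5!right; apply: shifted_prod_of_mixed_term sz _ => //; exact/eqP.
  have [z sz|G0|G1] := head_slope_0_or_1 hn hp passoc.
  - by apply: NNPP => gz; apply: none; exists z.
  - have [[c pE]|pE] := const_or_last_of_head_slope_0 hn hp passoc G0.
      by left; exists c => x; rewrite seqfun_codom -/(t x) pE.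
    have ltn1 : (n - 1 < n)%N by lia.
    right; right; left; exists (Ordinal ltn1) => // x.
    rewrite seqfun_codom -nth_t -/(t x).
    case/lastP: (t x) (st x) => [|v y]; rewrite ?size_rcons /= => sv; first by lia.
    have {}sv : size v = (n - 1)%N by lia.
    by rewrite pE // nth_rcons sv ltnn eqxx.
  - have [w [c [wc wn sE]]] := twisted_sum_of_head_slope_1 hn hp passoc G1.
    have pE x : p x = c + \sum_(i < n) w ^+ i * x i.
      rewrite seqfun_codom -/(t x) sE //; congr (c + _).
      by apply: eq_bigr => i _; rewrite nth_t.
    have n1 : n = (n - 1).+1 by lia.
    (* The value [w = 0] forces [c = 0] and gives the first projection, as [0 ^+ 0 = 1]; [w = 1]
       leaves [c] free; any other [w] forces [c = 0] and [w ^+ (n - 1) = 1]. *)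
    have [w0|wN0] := eqVneq w 0.
      have ltn0 : (0 < n)%N by lia.
      right; left; exists (Ordinal ltn0) => // x.
      rewrite pE -wc w0 mul0r add0r (bigD1 (Ordinal ltn0)) //= expr0 mul1r.
      rewrite big1 ?addr0 // => i; rewrite -val_eqE /= => i0.
      by rewrite expr0n (negPf i0) mul0r.
    have [w1|wN1] := eqVneq w 1.
      do 3!right; left; exists c => x; rewrite pE w1; congr (c + _).
      by apply: eq_bigr => i _; rewrite expr1n mul1r.
    have wn1 : w ^+ (n - 1) = 1.
      by apply: (mulfI wN0); rewrite -exprS -n1 mulr1.
    have c0 : c = 0.
      apply/eqP; move/eqP: wc; rewrite -subr_eq0 -{2}[c]mul1r -mulrBl mulf_eq0.
      by rewrite subr_eq0 (negPf wN1).
    do 4!right; left; split.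
      (* For [n = 2] the relation [w ^+ (n - 1) = 1] would say [w = 1]. *)
      rewrite ltn_neqAle hn andbT; apply: contra wN1 => /eqP n2.
      by rewrite -wn1 -n2 expr1.
    by exists w; split=> // x; rewrite pE c0 add0r.
case=> [[c pE]|[[i0 i00 pE]|[[i0 i0n pE]|[[c pE]|[[_ [w [_ wn pE]]]|[a [b [_ _ _ pE]]]]]]]].
- by move=> i j a; rewrite /nested !pE.
- suff H i a : nested p i a = a (idx_left i0) by move=> i j a; rewrite !H.
  rewrite /nested pE ffunE; case: ifP => // /negbT; rewrite -leqNgt i00 => i_0.
  have ii0 : i0 = i by apply: val_inj => /=; lia.
  by rewrite ii0 eqxx pE ffunE; congr (a _); apply: val_inj => /=; lia.
- suff H i a : nested p i a = a (idx_right i0) by move=> i j a; rewrite !H.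
  (* The last entry is the last outer argument, or the last inner one when [i = n - 1]; both have
     index [2 * n - 2]. *)
  have lti := ltn_ord i.
  rewrite /nested pE ffunE; case: ltnP => [|_]; first by lia.
  case: eqVneq => // <-; rewrite pE ffunE; congr (a _); apply: val_inj => /=; lia.
- apply: (@associative_twisted_sum _ _ 1 c) => [||x]; rewrite ?expr1n ?mul1r //.
  by rewrite pE; congr (c + _); apply: eq_bigr => i _; rewrite expr1n mul1r.
- by apply: (@associative_twisted_sum _ _ w 0) => // [|x]; rewrite ?mulr0 ?add0r.
- exact: associative_shifted_prod pE.
Qed.
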